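(* Let $(\mathfrak g,J,g)$ be an almost abelian pseudo-Kähler Lie algebra of dimension six, with codimension-one abelian ideal $\mathfrak h$, such that $\mathfrak h_0=\mathfrak h^\perp\oplus J\mathfrak h^\perp$ is isotropic. Then, after possibly replacing $g$ by $-g$, there is a basis $\{e_1,\dots,e_6\}$ of $\mathfrak g$ with $\mathfrak h=\mathrm{Span}\{e_1,\dots,e_5\}$ such that $$Je_1=e_2,\ Je_3=e_4,\ Je_5=e_6,\qquad g=e^1\odot e^6-e^2\odot e^5+e^3\otimes e^3+e^4\otimes e^4,$$ and the derivation $D=\mathrm{ad}(e_6)|_{\mathfrak h}$, written as a matrix in the basis $e_1,\dots,e_5$, is one of the following, with $\lambda,c_1,c_2\in\mathbb R$, $x\in\mathbb R_{\ge0}$: $$\begin{pmatrix}-1&0&0&0&0\\0&-1&0&0&c_2\\0&0&0&\lambda&0\\0&0&-\lambda&0&0\\0&0&0&0&1\end{pmatrix},\quad\begin{pmatrix}0&0&0&0&c_1\\0&0&0&0&1\\0&0&0&\lambda&0\\0&0&-\lambda&0&0\\0&0&0&0&0\end{pmatrix},\quad\begin{pmatrix}0&0&0&0&1\\0&0&0&0&0\\0&0&0&\lambda&0\\0&0&-\lambda&0&0\\0&0&0&0&0\end{pmatrix},\quad\begin{pmatrix}0&0&0&0&0\\0&0&0&0&0\\0&0&0&\lambda&0\\0&0&-\lambda&0&0\\0&0&0&0&0\end{pmatrix},$$ $$\begin{pmatrix}0&0&0&-1&0\\0&0&1&0&0\\0&0&0&0&1\\0&0&0&0&0\\0&0&0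&0&0\end{pmatrix},\quad\begin{pmatrix}0&0&0&-x&0\\0&0&x&0&1\\0&0&0&0&x\\0&0&0&0&0\\0&0&0&0&0\end{pmatrix}.$$
   Context: Lie algebras are real. A Lie algebra is almost abelian if it has a codimension-one abelian ideal $\mathfrak h$. A pseudo-Kähler structure on $\mathfrak g$ is a pair $(J,g)$ with $J\in\mathrm{End}(\mathfrak g)$, $J^2=-\mathrm{Id}$, $[X,Y]+J[JX,Y]+J[X,JY]-[JX,JY]=0$; $g$ a nondegenerate symmetric bilinear form of arbitrary signature with $g(JX,JY)=g(X,Y)$; and $\omega=g(J\cdot,\cdot)$ satisfying $\omega([X,Y],Z)+\omega([Y,Z],X)+\omega([Z,X],Y)=0$. The line $\mathfrak h^\perp$ is one-dimensional and $\mathfrak h_0$ is isotropic if $g|_{\mathfrak h_0}=0$. $\{e^i\}$ is the dual basis and $e^i\odot e^j=e^i\otimes e^j+e^j\otimes e^i$. *)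

(* Defs.v *)
From mathcomp Require Import all_boot all_order all_algebra.
From mathcomp Require Import sesquilinear reals.

Set Implicit Arguments.
Unset Strict Implicit.
Unset Printing Implicit Defensive.

Import GRing.Theory Num.Theory.
Local Open Scope ring_scope.

Section LieAlgebra.
Variables (R : realType) (V : vectType R) (br : {bilinear V -> V -> V}).
Implicit Types (J : 'End(V)) (g : {symmetric V}) (h : {vspace V}).

Definition is_lie_bracket : Prop :=
  (forall x, br x x = 0) /\
  (forall x y z, br x (br y z) + br y (br z x) + br z (br x y) = 0).

Definition is_lie_ideal h : Prop := forall x y, y \in h -> br x y \in h.

Definition is_abelian_sub h : Prop := {in h &, forall x y, br x y = 0}.

Definition is_codim1_abelian_ideal h : Prop :=
  [/\ (\dim h).+1 = \dim {:V}, is_lie_ideal h & is_abelian_sub h].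

Definition is_complex_structure J : Prop :=
  (forall x, J (J x) = - x) /\
  (forall x y, br x y + J (br (J x) y) + J (br x (J y)) - br (J x) (J y) = 0).

Definition is_closed2 (w : V -> V -> R) : Prop :=
  forall x y z, w (br x y) z + w (br y z) x + w (br z x) y = 0.

Definition is_pseudo_kahler J g : Prop :=
  [/\ is_complex_structure J,
      nondegenerate g,
      forall x y, g (J x) (J y) = g x y &
      is_closed2 (fun x y => g (J x) y)].

End LieAlgebra.

Section Forms.
Variables (R : realType) (V : vectType R).

Definition h0 (J : 'End(V)) (g : {symmetric V}) (h : {vspace V}) : {vspace V} :=
  (orthov g h + J @: orthov g h)%VS.

Definition is_isotropic (g : {symmetric V}) (U : {vspace V}) : Prop :=
  {in U &, forall x y, g x y = 0}.

Definition tens (a b : V -> R) (u v : V) : R := a u * b v.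

Definition symtens (a b : V -> R) (u v : V) : R := tens a b u v + tens b a u v.

(* The dual basis is indexed from 1, as in e^1, ..., e^6. *)
Definition std_metric (e : 6.-tuple V) (u v : V) : R :=
  let d (i : nat) : V -> R := coord e (inord i.-1) in
  symtens (d 1%N) (d 6%N) u v - symtens (d 2%N) (d 5%N) u v
  + tens (d 3%N) (d 3%N) u v + tens (d 4%N) (d 4%N) u v.

(* Column convention: column j holds the coordinates of f b_j in the free
   family b; meaningful when f maps the span of b to itself. *)
Definition matrix_in (n : nat) (b : n.-tuple V) (f : V -> V) : 'M[R]_n :=
  \matrix_(i < n, j < n) coord b i (f b`_j).

End Forms.

Section NormalForms.
Variable R : realType.
Implicit Types l c x : R.

Definition mx5 (rows : seq (seq R)) : 'M[R]_5 :=
  \matrix_(i < 5, j < 5) (nth [::] rows i)`_j.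

Definition D1 l c2 : 'M[R]_5 := mx5
  [:: [:: -1;  0;  0; 0;  0];
      [::  0; -1;  0; 0; c2];
      [::  0;  0;  0; l;  0];
      [::  0;  0; -l; 0;  0];
      [::  0;  0;  0; 0;  1]].

Definition D2 l c1 : 'M[R]_5 := mx5
  [:: [:: 0; 0;  0; 0; c1];
      [:: 0; 0;  0; 0;  1];
      [:: 0; 0;  0; l;  0];
      [:: 0; 0; -l; 0;  0];
      [:: 0; 0;  0; 0;  0]].

Definition D3 l : 'M[R]_5 := mx5
  [:: [:: 0; 0;  0; 0; 1];
      [:: 0; 0;  0; 0; 0];
      [:: 0; 0;  0; l; 0];
      [:: 0; 0; -l; 0; 0];
      [:: 0; 0;  0; 0; 0]].

Definition D4 l : 'M[R]_5 := mx5
  [:: [:: 0; 0;  0; 0; 0];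
      [:: 0; 0;  0; 0; 0];
      [:: 0; 0;  0; l; 0];
      [:: 0; 0; -l; 0; 0];
      [:: 0; 0;  0; 0; 0]].

Definition D5 : 'M[R]_5 := mx5
  [:: [:: 0; 0; 0; -1; 0];
      [:: 0; 0; 1;  0; 0];
      [:: 0; 0; 0;  0; 1];
      [:: 0; 0; 0;  0; 0];
      [:: 0; 0; 0;  0; 0]].

Definition D6 x : 'M[R]_5 := mx5
  [:: [:: 0; 0; 0; -x; 0];
      [:: 0; 0; x;  0; 1];
      [:: 0; 0; 0;  0; x];
      [:: 0; 0; 0;  0; 0];
      [:: 0; 0; 0;  0; 0]].

Definition is_normal_form (D : 'M[R]_5) : Prop :=
  (exists l c2, D = D1 l c2) \/
  (exists l c1, D = D2 l c1) \/
  (exists l, D = D3 l) \/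
  (exists l, D = D4 l) \/
  D = D5 \/
  (exists x, 0 <= x /\ D = D6 x).

End NormalForms.

(* Main.v *)
From HB Require Import structures.
Require Import Defs.
From mathcomp Require Import all_boot all_order all_algebra.
From mathcomp Require Import sesquilinear boolp reals ring lra.

Set Implicit Arguments.
Unset Strict Implicit.
Unset Printing Implicit Defensive.

Import Order.TTheory GRing.Theory Num.Theory.
Local Open Scope ring_scope.

(** Put e2 = J e1, where e1 spans the line orthogonal to h.  Isotropy of h0
puts e1 and e2 inside h, and a null vector e5 of h with g e1 (J e5) = 1
completes them to a J-stable neutral 4-space.  On its orthogonal plane g is
definite, of a sign s that is absorbed by replacing g by -g; a unit vector e3
there gives a frame e1, J e1, e3, J e3, e5, J e5 in which J and g have the
required form ([exists_adapted]).

In such a frame the geometry becomes algebra on D = ad (J e5).  Integrability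
says that D commutes with J where both sides are defined, that is on
e1, ..., e4 ([ad_J]); closedness of the Kaehler form says that D is
skew for g (J _) _ on h ([ad_skew]).  Together they leave six free real
parameters a, b1, b2, l, c1, c2 ([exists_ad_shape]): on e1, ..., e4 the map D
is the complex upper triangular matrix with diagonal a, - i l and corner
b1 + i b2, and D e5 has free components c1, c2 along e1, e2, the others being
forced.

The frame is unique up to three moves, each of which changes the parameters by
an explicit formula: a shift of e5 (and, correspondingly, of e3) by multiples
of the other vectors, a rotation of the plane of e3, and the rescaling of e1
and e5 by r and 1/r.  The normal forms are representatives of the orbits
([exists_normal_parameters]):
- if a is nonzero, rescale it to -1; the diagonal entries a and - i l are then
  distinct, so a shift removes b, and another one removes c1 (first form);
- if a = 0 and l is nonzero, the diagonal entries still differ, so b can be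
  removed; then, as when a = l = b = 0, only rescaling acts on c, by a cube,
  which gives the second, third and fourth forms;
- if a = l = 0 and b is nonzero, rotate b to (0, n) with n > 0 and shift c1
  away; c2 cannot be moved except by scaling, so it is 0 or 1 in the end, and
  these are the last two forms.

All the computations are done on coordinates: [comb] writes a vector in a
frame, and every vector identity becomes a list of six identities in R. *)

(** * Symmetric bilinear forms *)

Section SymmetricForm.
Variables (R : realType) (V : vectType R) (g : {symmetric V}).

Lemma symC u v : g u v = g v u.
Proof. by rewrite hermC expr0 mul1r. Qed.

Lemma symDl u v w : g (u + v) w = g u w + g v w.
Proof. exact: linearDl. Qed.

Lemma symDr u v w : g w (u + v) = g w u + g w v.
Proof. exact: linearDr. Qed.

Lemma symZl a u w : g (a *: u) w = a * g u w.
Proof. by rewrite linearZl_LR. Qed.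

Lemma symZr a u w : g w (a *: u) = a * g w u.
Proof. by rewrite linearZr_LR. Qed.

Lemma symNr u w : g w (- u) = - g w u.
Proof. by rewrite -scaleN1r symZr mulN1r. Qed.

Lemma symNl u w : g (- u) w = - g u w.
Proof. by rewrite symC symNr symC. Qed.

Definition symE := (symDl, symDr, symZl, symZr, symNl, symNr).

Lemma nondegenerate_neq0 u : nondegenerate g -> u != 0 -> exists v, g u v != 0.
Proof.
move=> /eqP nd u0; have : u \notin orthov g fullv by rewrite nd memv0.
by case/mem_orthovPn=> v _; exists v.
Qed.

(** The form restricted to [h] in the second variable is a linear map to a
space of dimension [\dim h], so its kernel is nonzero. *)
Lemma exists_orthov (h : {vspace V}) :
  (\dim h < \dim {:V})%N -> exists2 e, e != 0 & {in h, forall x, g e x = 0}.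
Proof.
move=> hV; pose f (u : V) : 'rV[R]_(\dim h) := \row_i g u (vbasis h)`_i.
have lf : linear f by move=> k u v; apply/rowP=> i; rewrite !mxE !symE.
pose F := GRing.isLinear.Build _ _ _ _ f lf.
pose fl : {linear V -> 'rV[R]_(\dim h)} := HB.pack f F.
have := limg_ker_dim (linfun fl) fullv; rewrite capfv.
have le : (\dim (linfun fl @: fullv) <= \dim h)%N.
  by apply: leq_trans (dimvS (subvf _)) _; rewrite dimvf /dim/= mul1n.
move=> dimE; have : (0 < \dim (lker (linfun fl)))%N.
  by rewrite lt0n; apply/eqP=> k0; move: hV; rewrite -dimE k0 add0n ltnNge le.
rewrite lt0n dimv_eq0 -vpick0 => p0; exists (vpick (lker (linfun fl))) => // x xh.
have := memv_pick (lker (linfun fl)); rewrite memv_ker lfunE /= => /eqP/rowP pk.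
rewrite (coord_vbasis xh) linear_sumr big1 // => i _.
have := pk i; rewrite !mxE => gi0; by apply: etrans (symZr _ _ _) _; rewrite gi0 mulr0.
Qed.

End SymmetricForm.

(** * Coordinates in an adapted frame *)

Section Frame.
Variables (R : realType) (V : vectType R).
Variables (J : 'End(V)) (g : {symmetric V}) (h : {vspace V}).
Hypothesis JJ : forall x, J (J x) = - x.
Hypothesis gJJ : forall x y, g (J x) (J y) = g x y.
Hypothesis dimV : \dim {:V} = 6%N.

Lemma gJl x y : g (J x) y = - g x (J y).
Proof. by rewrite -gJJ JJ symNl. Qed.

Lemma gJ_diag x : g x (J x) = 0.
Proof.
have := gJl x x; rewrite (symC _ (J x)) => /eqP.
by rewrite -addr_eq0 -mulr2n mulrn_eq0 => /eqP.
Qed.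

Definition comb (e1 e3 e5 : V) (x1 x2 x3 x4 x5 x6 : R) : V :=
  x1 *: e1 + x2 *: J e1 + x3 *: e3 + x4 *: J e3 + x5 *: e5 + x6 *: J e5.

(** Only the metric relations that invariance under [J] does not imply are
listed; the factor [sg], which will be 1 or -1, is the sign by which the metric
differs from the standard one. *)
Definition adapted (sg : R) (e1 e3 e5 : V) : Prop :=
  [/\ forall x, (x \in h) = (g e1 x == 0),
      [/\ g e1 e1 = 0, g e1 e3 = 0, g e1 (J e3) = 0 & g e1 e5 = 0],
      [/\ g e3 e5 = 0, g e3 (J e5) = 0 & g e5 e5 = 0],
      g e3 e3 = sg & g e1 (J e5) = sg].

Section Coordinates.
Variables e1 e3 e5 : V.
Notation vec := (comb e1 e3 e5).

Lemma combD x1 x2 x3 x4 x5 x6 y1 y2 y3 y4 y5 y6 :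
  vec x1 x2 x3 x4 x5 x6 + vec y1 y2 y3 y4 y5 y6 =
  vec (x1 + y1) (x2 + y2) (x3 + y3) (x4 + y4) (x5 + y5) (x6 + y6).
Proof.
rewrite /comb; do 5!(rewrite [LHS]addrACA -scalerDl; congr (_ + _)).
by rewrite -scalerDl.
Qed.

Lemma combZ a x1 x2 x3 x4 x5 x6 :
  a *: vec x1 x2 x3 x4 x5 x6 =
  vec (a * x1) (a * x2) (a * x3) (a * x4) (a * x5) (a * x6).
Proof. by rewrite /comb !scalerDr !scalerA. Qed.

Lemma J_comb x1 x2 x3 x4 x5 x6 :
  J (vec x1 x2 x3 x4 x5 x6) = vec (- x2) x1 (- x4) x3 (- x6) x5.
Proof.
rewrite /comb !linearD !linearZ /= !JJ !scalerN !scaleNr.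
rewrite (addrC (x1 *: _)) -!addrA; congr (_ + (_ + _)).
by rewrite addrCA; congr (_ + (_ + _)); rewrite addrC.
Qed.

Lemma combE1 : e1 = vec 1 0 0 0 0 0.
Proof. by rewrite /comb !scale0r scale1r !addr0. Qed.

Lemma combE3 : e3 = vec 0 0 1 0 0 0.
Proof. by rewrite /comb !scale0r scale1r !(addr0, add0r). Qed.

Lemma combE5 : e5 = vec 0 0 0 0 1 0.
Proof. by rewrite /comb !scale0r scale1r !(addr0, add0r). Qed.

Lemma combE6 : J e5 = vec 0 0 0 0 0 1.
Proof. by rewrite /comb !scale0r scale1r !(addr0, add0r). Qed.

Variable sg : R.
Hypothesis sg1 : sg * sg = 1.
Hypothesis fr : adapted sg e1 e3 e5.

Lemma metric_comb x1 x2 x3 x4 x5 x6 y1 y2 y3 y4 y5 y6 :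
  g (vec x1 x2 x3 x4 x5 x6) (vec y1 y2 y3 y4 y5 y6) =
  sg * (x1 * y6 + x6 * y1 - (x2 * y5 + x5 * y2) + x3 * y3 + x4 * y4).
Proof.
case: fr => _ [g11 g13 g14 g15] [g35 g36 g55] g33 g16.
have g26 : g (J e1) (J e5) = 0 by rewrite gJJ.
have g25 : g (J e1) e5 = - sg by rewrite gJl g16.
have g23 : g (J e1) e3 = 0 by rewrite gJl g14 oppr0.
have g45 : g (J e3) e5 = 0 by rewrite gJl g36 oppr0.
rewrite /comb !symE !gJJ !gJ_diag.
rewrite !(symC _ (J e1) e1) !(symC _ (J e3) e3) !(symC _ (J e5) e5) !gJ_diag.
rewrite !(symC _ e3 e1) !(symC _ e5 e1) !(symC _ e5 e3).
rewrite !(symC _ (J e3) e1) !(symC _ (J e5) e1) !(symC _ (J e5) e3).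
rewrite !(symC _ e3 (J e1)) !(symC _ e5 (J e1)) !(symC _ e5 (J e3)).
rewrite g11 g13 g14 g15 g35 g36 g55 g33 g16 g25 g23 g45; ring.
Qed.

Lemma sg_neq0 : sg != 0.
Proof. by apply/eqP=> s0; move/eqP: sg1; rewrite s0 mul0r eq_sym oner_eq0. Qed.

(** Pairing with each frame vector isolates one coordinate, up to sign. *)
Lemma comb_eq0 x1 x2 x3 x4 x5 x6 :
  vec x1 x2 x3 x4 x5 x6 = 0 ->
  [/\ x1 = 0, x2 = 0 & x3 = 0] /\ [/\ x4 = 0, x5 = 0 & x6 = 0].
Proof.
move=> v0; have gv0 y1 y2 y3 y4 y5 y6 :
    x1 * y6 + x6 * y1 - (x2 * y5 + x5 * y2) + x3 * y3 + x4 * y4 = 0.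
  apply: (mulfI sg_neq0); rewrite -metric_comb v0 mulr0.
  by rewrite -(scale0r 0) symZl mul0r.
have c1 := gv0 0 0 0 0 0 1; have c2 := gv0 0 0 0 0 1 0.
have c3 := gv0 0 0 1 0 0 0; have c4 := gv0 0 0 0 1 0 0.
have c5 := gv0 0 1 0 0 0 0; have c6 := gv0 1 0 0 0 0 0.
by split; split; lra.
Qed.

Lemma comb_sum (t : 6.-tuple V) (c : 'I_6 -> R) :
  t = [tuple e1; J e1; e3; J e3; e5; J e5] ->
  \sum_(i < 6) c i *: t`_i = vec (c (inord 0)) (c (inord 1)) (c (inord 2))
                               (c (inord 3)) (c (inord 4)) (c (inord 5)).
Proof.
move=> ->; rewrite !big_ord_recl big_ord0 /= addr0 /comb !addrA.
by congr (_ + _ + _ + _ + _ + _); congr (c _ *: _); apply: val_inj; rewrite /= inordK.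
Qed.

Lemma adapted_free : free [tuple e1; J e1; e3; J e3; e5; J e5].
Proof.
apply/freeP=> k; rewrite (comb_sum _ erefl) => /comb_eq0 [[k0 k1 k2] [k3 k4 k5]] i.
by rewrite -(inord_val i); case: i => -[|[|[|[|[|[]]]]]].
Qed.

Lemma adapted_basis : basis_of {:V} [tuple e1; J e1; e3; J e3; e5; J e5].
Proof. by rewrite basisEfree adapted_free subvf dimV. Qed.

Lemma comb_surj v : exists x1 x2 x3 x4 x5 x6, v = vec x1 x2 x3 x4 x5 x6.
Proof.
rewrite (coord_basis adapted_basis (memvf v)) (comb_sum _ erefl).
by do 6!eexists.
Qed.

Lemma mem_comb x1 x2 x3 x4 x5 x6 :
  (vec x1 x2 x3 x4 x5 x6 \in h) = (x6 == 0).
Proof.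
case: (fr) => -> _ _ _ _; rewrite {1}combE1 metric_comb.
by rewrite !(mul0r, mul1r, addr0, add0r, oppr0) mulf_eq0 (negPf sg_neq0).
Qed.

End Coordinates.
End Frame.

(** * The shape of the derivation *)

Section Derivation.
Variables (R : realType) (V : vectType R) (br : {bilinear V -> V -> V}).
Variables (J : 'End(V)) (g : {symmetric V}) (h : {vspace V}).
Hypothesis dimV : \dim {:V} = 6%N.
Hypothesis br_lie : is_lie_bracket br.
Hypothesis h_ideal : is_codim1_abelian_ideal br h.
Hypothesis Jg_pK : is_pseudo_kahler br J g.
Variable sg : R.
Hypothesis sg1 : sg * sg = 1.

Let JJ x : J (J x) = - x.
Proof. by case: Jg_pK => -[]. Qed.

Let gJJ x y : g (J x) (J y) = g x y.
Proof. by case: Jg_pK. Qed.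

Let br_h x y : x \in h -> y \in h -> br x y = 0.
Proof. by case: h_ideal => _ _; apply. Qed.

Lemma brC x y : br x y = - br y x.
Proof.
case: br_lie => brxx _; apply/eqP; rewrite -addr_eq0; apply/eqP.
by have := brxx (x + y); rewrite linearDl !linearDr /= !brxx addr0 add0r.
Qed.

(** On the span of [e1], [J e1], [e3], [J e3] this is the complex matrix with
rows (a, b1 + i b2) and (0, - i l); the last coordinate of the argument is 0
because [J e5] acts on the ideal only. *)
Definition ad_shape (e1 e3 e5 : V) (a b1 b2 l c1 c2 : R) : Prop :=
  forall y1 y2 y3 y4 y5,
  br (J e5) (comb J e1 e3 e5 y1 y2 y3 y4 y5 0) =
  comb J e1 e3 e5 (a * y1 + b1 * y3 - b2 * y4 + c1 * y5)
                  (a * y2 + b2 * y3 + b1 * y4 + c2 * y5)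
                  (l * y4 + b2 * y5) (- l * y3 + b1 * y5) (- a * y5) 0.

(** Of the four terms of the integrability condition for [x] and [z], the two
that involve [J z] are brackets inside the abelian ideal. *)
Lemma ad_J z x : J z \in h -> x \in h -> J x \in h -> br z (J x) = J (br z x).
Proof.
case: Jg_pK => -[_ NJ] _ _ _ zh xh Jxh.
have := NJ x z; rewrite (br_h xh zh) (br_h Jxh zh) linear0 addr0 subr0.
rewrite (brC x z) (brC (J x) z) linearN /= => /eqP; rewrite subr_eq0 => /eqP brE.
by have := congr1 J brE; rewrite linearN JJ => /oppr_inj ->.
Qed.

(** Closedness on [z], [x], [y]: the term with the bracket of [x] and [y]
vanishes. *)
Lemma ad_skew z x y : x \in h -> y \in h ->
  g (J (br z x)) y + g (J x) (br z y) = 0.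
Proof.
move=> xh yh; case: Jg_pK => _ _ _ /(_ z x y).
rewrite (br_h xh yh) (brC y z) !linearN /= !symNl.
by rewrite linear0 -(scale0r 0) symZl mul0r addr0 (gJl JJ gJJ (br z y)) opprK symC
  (symC _ _ (br z y)).
Qed.

(** The coordinates of the images of [e1], [e3], [e5] are 18 unknowns.  Since the
ideal and its intersection with its image under [J] are preserved, five of them
vanish, and skewness on pairs of frame vectors gives seven linear equations
among the others. *)
Lemma exists_ad_shape e1 e3 e5 : adapted J g h sg e1 e3 e5 ->
  exists a b1 b2 l c1 c2, ad_shape e1 e3 e5 a b1 b2 l c1 c2.
Proof.
move=> fr; set z := J e5.
have memE := mem_comb JJ gJJ sg1 fr; have gE := metric_comb JJ gJJ fr.
have JE := J_comb JJ e1 e3 e5.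
have Dh x : x \in h -> br z x \in h by case: h_ideal => _ id _ /id.
have Jzh : J z \in h.
  by rewrite JJ (combE5 J e1 e3 e5) -scaleN1r combZ memE mulr0.
have e1E := combE1 J e1 e3 e5; have e3E := combE3 J e1 e3 e5.
have e5E := combE5 J e1 e3 e5.
have e1h : e1 \in h by rewrite e1E memE.
have e3h : e3 \in h by rewrite e3E memE.
have e5h : e5 \in h by rewrite e5E memE.
have Je1h : J e1 \in h by rewrite e1E JE memE.
have Je3h : J e3 \in h by rewrite e3E JE memE.
have [p1 [p2 [p3 [p4 [p5 [p6 De1]]]]]] := comb_surj JJ gJJ dimV sg1 fr (br z e1).
have [q1 [q2 [q3 [q4 [q5 [q6 De3]]]]]] := comb_surj JJ gJJ dimV sg1 fr (br z e3).
have [r1 [r2 [r3 [r4 [r5 [r6 De5]]]]]] := comb_surj JJ gJJ dimV sg1 fr (br z e5).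
have De2 := ad_J Jzh e1h Je1h; have De4 := ad_J Jzh e3h Je3h.
have /eqP p6E : p6 == 0 by rewrite -(memE p1 p2 p3 p4 p5) -De1 Dh.
have /eqP q6E : q6 == 0 by rewrite -(memE q1 q2 q3 q4 q5) -De3 Dh.
have /eqP r6E : r6 == 0 by rewrite -(memE r1 r2 r3 r4 r5) -De5 Dh.
have /eqP p5E : p5 == 0 by rewrite -(memE (- p2) p1 (- p4) p3 (- p6)) -JE -De1 -De2 Dh.
have /eqP q5E : q5 == 0 by rewrite -(memE (- q2) q1 (- q4) q3 (- q6)) -JE -De3 -De4 Dh.
subst p6 q6 r6 p5 q5.
have sg0 := sg_neq0 sg1.
have e2E : J e1 = comb J e1 e3 e5 0 1 0 0 0 0 by rewrite {1}e1E JE oppr0.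
have e4E : J e3 = comb J e1 e3 e5 0 0 0 1 0 0 by rewrite {1}e3E JE oppr0.
rewrite De1 JE in De2; rewrite De3 JE in De4.
(* [ad_skew] in coordinates, divided by [sg]. *)
have skew x y x1 x2 x3 x4 x5 y1 y2 y3 y4 y5 u1 u2 u3 u4 u5 v1 v2 v3 v4 v5
    (xE : x = comb J e1 e3 e5 x1 x2 x3 x4 x5 0)
    (yE : y = comb J e1 e3 e5 y1 y2 y3 y4 y5 0)
    (Dx : br z x = comb J e1 e3 e5 u1 u2 u3 u4 u5 0)
    (Dy : br z y = comb J e1 e3 e5 v1 v2 v3 v4 v5 0) :
    u5 * y1 - u1 * y5 - u4 * y3 + u3 * y4 +
    (v1 * x5 - v5 * x1 - v3 * x4 + v4 * x3) = 0.
  have xh : x \in h by rewrite xE memE.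
  have yh : y \in h by rewrite yE memE.
  have := ad_skew z xh yh; rewrite Dx Dy xE yE !JE !gE -mulrDr => /eqP.
  rewrite mulf_eq0 (negPf sg0) /= => /eqP <-; ring.
rewrite oppr0 in De2 De4.
have s23 := skew _ _ _ _ _ _ _ _ _ _ _ _ _ _ _ _ _ _ _ _ _ _ e2E e3E De2 De3.
have s24 := skew _ _ _ _ _ _ _ _ _ _ _ _ _ _ _ _ _ _ _ _ _ _ e2E e4E De2 De4.
have s25 := skew _ _ _ _ _ _ _ _ _ _ _ _ _ _ _ _ _ _ _ _ _ _ e2E e5E De2 De5.
have s34 := skew _ _ _ _ _ _ _ _ _ _ _ _ _ _ _ _ _ _ _ _ _ _ e3E e4E De3 De4.
have s15 := skew _ _ _ _ _ _ _ _ _ _ _ _ _ _ _ _ _ _ _ _ _ _ e1E e5E De1 De5.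
have s35 := skew _ _ _ _ _ _ _ _ _ _ _ _ _ _ _ _ _ _ _ _ _ _ e3E e5E De3 De5.
have s45 := skew _ _ _ _ _ _ _ _ _ _ _ _ _ _ _ _ _ _ _ _ _ _ e4E e5E De4 De5.
have p2E : p2 = 0 by lra.
have p3E : p3 = 0 by lra.
have p4E : p4 = 0 by lra.
have q3E : q3 = 0 by lra.
have r3E : r3 = q2 by lra.
have r4E : r4 = q1 by lra.
have r5E : r5 = - p1 by lra.
subst p2 p3 p4 q3 r3 r4 r5.
exists p1, q1, q2, (- q4), r1, r2 => y1 y2 y3 y4 y5.
rewrite {1}/comb !linearD !linearZ /= -/z De1 De2 De3 De4 De5 scale0r addr0.
rewrite !combZ !combD; congr comb; ring.
Qed.
End Derivation.

(** * Existence of an adapted frame *)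

Section AdaptedFrame.
Variables (R : realType) (V : vectType R).
Variables (J : 'End(V)) (g : {symmetric V}) (h : {vspace V}).
Hypothesis JJ : forall x, J (J x) = - x.
Hypothesis gJJ : forall x y, g (J x) (J y) = g x y.
Hypothesis dimV : \dim {:V} = 6%N.
Hypothesis nd : nondegenerate g.

(** The ideal lies in the hyperplane orthogonal to [e], which is proper by
nondegeneracy, and the dimensions agree. *)
Lemma orthogonal_hyperplane e : e != 0 -> {in h, forall x, g e x = 0} ->
  (\dim h).+1 = \dim {:V} -> forall x, (x \in h) = (g e x == 0).
Proof.
move=> e0 eh dimh x; have [v gev] := nondegenerate_neq0 nd e0.
have -> : h = orthov g <[e]>.
  apply/eqP; rewrite eqEdim; apply/andP; split.
    by apply/subvP=> y yh; rewrite mem_orthov1 symC eh.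
  rewrite -ltnS dimh ltnNge; apply/negP=> le.
  have : orthov g <[e]> == fullv by rewrite eqEdim subvf.
  by move/eqP/vspaceP/(_ v); rewrite memvf mem_orthov1 symC (negPf gev).
by rewrite mem_orthov1 symC.
Qed.

(** Starting from any [v] not orthogonal to [e1], a combination [f] of [v] and
[J v] satisfies the two conditions that are linear in it.  Adding a multiple
of [J e1] keeps them and makes the vector null. *)
Lemma exists_null_partner e1 : e1 != 0 -> g e1 e1 = 0 ->
  exists e5, [/\ g e1 e5 = 0, g e5 e5 = 0 & g e1 (J e5) = 1].
Proof.
move=> e10 g11; have [v gv] := nondegenerate_neq0 nd e10.
set p := g e1 v in gv; set q := g (J e1) v.
have gJv : g e1 (J v) = - q by rewrite /q (gJl JJ gJJ) opprK.
have r0 : p ^+ 2 + q ^+ 2 != 0.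
  by rewrite paddr_eq0 ?sqr_ge0 // sqrf_eq0 (negPf gv).
(* [J f] is the combination x of [v] and [J v] with g e1 x = 1, g (J e1) x = 0. *)
pose f := (q / (p ^+ 2 + q ^+ 2)) *: (- v) - (p / (p ^+ 2 + q ^+ 2)) *: J v.
have g1f : g e1 f = 0 by rewrite !symE -/p gJv; field.
have g1Jf : g e1 (J f) = 1.
  rewrite linearB !linearZ linearN /= JJ !symE -/p gJv; field.
  exact: r0.
clearbody f; exists (f + (g f f / 2) *: J e1); split.
- by rewrite !symE g1f gJ_diag // mulr0 addr0.
- by rewrite !symE gJJ g11 (symC _ f) (gJl JJ gJJ) g1Jf; field.
- by rewrite linearD linearZ /= JJ !symE g1Jf g11; ring.
Qed.

(** If every vector orthogonal to the 4-space W spanned by [e1], [J e1], [e5],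
[J e5] were null, then by polarization g would vanish on that orthogonal
space, hence so would the space itself: as W is nondegenerate, it is a
complement of W.  Then W would be everything, against [dimV]. *)
Lemma exists_nonnull_orthogonal e1 e5 : g e1 e1 = 0 -> g e1 e5 = 0 ->
    g e5 e5 = 0 -> g e1 (J e5) = 1 ->
  exists2 u, [/\ g e1 u = 0, g e1 (J u) = 0, g e5 u = 0 & g e5 (J u) = 0]
           & g u u != 0.
Proof.
move=> g11 g15 g55 g16.
have g51 : g e5 e1 = 0 by rewrite symC.
have g52 : g e5 (J e1) = - 1 by rewrite symC (gJl JJ gJJ) g16.
pose orth u := [/\ g e1 u = 0, g e1 (J u) = 0, g e5 u = 0 & g e5 (J u) = 0].
have [//|null] := pselect (exists2 u, orth u & g u u != 0).
have {}null u : orth u -> g u u = 0.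
  by move=> ou; apply/eqP/negPn/negP=> gu; apply: null; exists u.
(* [v] minus its orthogonal projection on W. *)
have proj v : exists x1 x2 x3 x4,
    orth (v - (x1 *: e1 + x2 *: J e1 + x3 *: e5 + x4 *: J e5)).
  have JE x1 x2 x3 x4 : J (v - (x1 *: e1 + x2 *: J e1 + x3 *: e5 + x4 *: J e5)) =
            J v - (x1 *: J e1 + x2 *: - e1 + x3 *: J e5 + x4 *: - e5).
    by rewrite linearB !linearD !linearZ /= !JJ.
  exists (- g e5 (J v)), (- g e5 v), (g e1 (J v)), (g e1 v); rewrite /orth JE.
  split; rewrite !symE ?g11 ?g15 ?g55 ?g16 ?g51 ?g52 ?gJ_diag //; ring.
have orth0 u : orth u -> u = 0.
  move=> ou; apply: contrapT => /eqP u0.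
  have [w] := nondegenerate_neq0 nd u0; apply/negP/negPn/eqP.
  (* W is orthogonal to [u], so [w] may be replaced by its component off W. *)
  have [w' ow gw] : exists2 w', orth w' & g u w = g u w'.
    have [x1 [x2 [x3 [x4 ow]]]] := proj w.
    exists (w - (x1 *: e1 + x2 *: J e1 + x3 *: e5 + x4 *: J e5)) => //.
    case: ou => u1 u2 u3 u4; rewrite !symE.
    rewrite (symC _ u e1) (symC _ u e5) (symC _ u (J e1)) (symC _ u (J e5)).
    by rewrite !(gJl JJ gJJ) u1 u2 u3 u4; ring.
  have ouw : orth (u + w').
    case: ou ow => [u1 u2 u3 u4] [w1 w2 w3 w4].
    have Juw : J (u + w') = J u + J w' by rewrite linearD.
    by split; rewrite ?Juw symDr ?u1 ?u2 ?u3 ?u4 ?w1 ?w2 ?w3 ?w4 addr0.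
  have gw' : g u w' = 0.
    have := null _ ouw; rewrite !symE (null _ ou) (null _ ow) (symC _ w' u).
    by lra.
  by rewrite gw gw'.
have sub : (fullv <= <<[:: e1; J e1; e5; J e5]>>)%VS.
  apply/subvP=> v _; have [x1 [x2 [x3 [x4 /orth0/eqP]]]] := proj v.
  rewrite subr_eq0 => /eqP ->.
  by rewrite !rpredD // rpredZ // memv_span // !inE eqxx ?orbT.
by have := leq_trans (dimvS sub) (dim_span _); rewrite dimV.
Qed.

(** The line orthogonal to the ideal is spanned by some [e1]; [e1] lies in
[h0], whose isotropy makes it null. *)
Lemma exists_adapted : (\dim h).+1 = \dim {:V} -> is_isotropic g (h0 J g h) ->
  exists (s : bool) e1 e3 e5, adapted J g h ((-1) ^+ s) e1 e3 e5.
Proof.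
move=> dimh iso.
have [e1 e10 e1h] : exists2 e, e != 0 & {in h, forall x, g e x = 0}.
  by apply: exists_orthov; rewrite -dimh.
have e1h0 : e1 \in h0 J g h.
  by rewrite (subvP (addvSl _ _)) //; apply/mem_orthovP.
have g11 := iso _ _ e1h0 e1h0.
have [e5 [g15 g55 g16]] := exists_null_partner e10 g11.
have [u [u1 u2 u3 u4] gu] := exists_nonnull_orthogonal g11 g15 g55 g16.
(* The sign of [g u u] on [e5] turns g e1 (J e5) = 1 into the same sign as
   g e3 e3. *)
have JZ k x : J (k *: x) = k *: J x by rewrite linearZ.
exists (g u u < 0), e1, ((Num.sqrt `|g u u|)^-1 *: u),
  ((-1) ^+ (g u u < 0)%R *: e5).
split.
- exact: orthogonal_hyperplane.
- by rewrite JZ !symZr g11 g15 u1 u2 !mulr0.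
- rewrite !JZ !symE g55 (symC _ u e5) (symC _ u (J e5)).
  by rewrite (gJl JJ gJJ) u3 u4 oppr0 !mulr0.
- rewrite !symE mulrA -invfM -expr2 sqr_sqrtr //.
  by rewrite {2}(numEsign (g u u)) mulrCA mulVf ?mulr1 // normr_eq0.
- by rewrite JZ symZr g16 mulr1.
Qed.

End AdaptedFrame.

(** * Change of frame *)

Section NormalizationMoves.
Variables (R : realType) (V : vectType R) (br : {bilinear V -> V -> V}).
Variables (J : 'End(V)) (g : {symmetric V}) (h : {vspace V}).
Hypothesis h_ideal : is_codim1_abelian_ideal br h.
Hypothesis JJ : forall x, J (J x) = - x.
Hypothesis gJJ : forall x y, g (J x) (J y) = g x y.
Variable sg : R.
Hypothesis sg1 : sg * sg = 1.

Definition admissible (a b1 b2 l c1 c2 : R) : Prop :=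
  exists e1 e3 e5, adapted J g h sg e1 e3 e5 /\
                   ad_shape br J e1 e3 e5 a b1 b2 l c1 c2.

(** Two elements of the ideal commute, so only the [J e5] component of the first
argument acts. *)
Lemma br_comb e1 e3 e5 a b1 b2 l c1 c2 :
  adapted J g h sg e1 e3 e5 -> ad_shape br J e1 e3 e5 a b1 b2 l c1 c2 ->
  forall x1 x2 x3 x4 x5 x6 y1 y2 y3 y4 y5,
  br (comb J e1 e3 e5 x1 x2 x3 x4 x5 x6) (comb J e1 e3 e5 y1 y2 y3 y4 y5 0) =
  x6 *: comb J e1 e3 e5 (a * y1 + b1 * y3 - b2 * y4 + c1 * y5)
                        (a * y2 + b2 * y3 + b1 * y4 + c2 * y5)
                        (l * y4 + b2 * y5) (- l * y3 + b1 * y5) (- a * y5) 0.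
Proof.
move=> fr ad x1 x2 x3 x4 x5 x6 y1 y2 y3 y4 y5.
have -> : comb J e1 e3 e5 x1 x2 x3 x4 x5 x6 =
          comb J e1 e3 e5 x1 x2 x3 x4 x5 0 + x6 *: J e5.
  by rewrite /comb scale0r addr0.
rewrite linearDl linearZl_LR /= ad.
case: h_ideal => _ _ -> //; rewrite ?add0r //; by rewrite (mem_comb JJ gJJ sg1 fr).
Qed.

(** The new [e5] is e5 + w1 e3 + w2 (J e3) + t e1, with the multiple of [J e1]
that keeps it null, and the new [e3] is moved so as to stay orthogonal to it
and to its image under [J]. *)
Lemma admissible_shift a b1 b2 l c1 c2 w1 w2 t : admissible a b1 b2 l c1 c2 ->
  let b1' := b1 + a * w2 - l * w1 in
  let b2' := b2 + a * w1 + l * w2 in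
  admissible a b1' b2' l
    (c1 + w1 * b1 - w2 * b2 + 2 * a * t + w1 * b1' - w2 * b2')
    (c2 + w1 * b2 + w2 * b1 + a * (w1 ^+ 2 + w2 ^+ 2) - w1 * b2' - w2 * b1').
Proof.
move=> [e1 [e3 [e5 [fr ad]]]] b1' b2'.
have gE := metric_comb JJ gJJ fr; have brE := br_comb fr ad.
pose f3 := comb J e1 e3 e5 w2 w1 1 0 0 0.
pose f5 := comb J e1 e3 e5 t ((w1 ^+ 2 + w2 ^+ 2) / 2) w1 w2 1 0.
(* Coordinates in the new frame, converted to the old one. *)
have combE y1 y2 y3 y4 y5 y6 : comb J e1 f3 f5 y1 y2 y3 y4 y5 y6 =
    comb J e1 e3 e5 (y1 + w2 * y3 - w1 * y4 + t * y5 - (w1 ^+ 2 + w2 ^+ 2) / 2 * y6)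
      (y2 + w1 * y3 + w2 * y4 + (w1 ^+ 2 + w2 ^+ 2) / 2 * y5 + t * y6)
      (y3 + w1 * y5 - w2 * y6) (y4 + w2 * y5 + w1 * y6) y5 y6.
  rewrite {1}/comb {1 2}(combE1 J e1 e3 e5) /f3 /f5 !(J_comb JJ) !combZ !combD.
  by congr comb; ring.
exists e1, f3, f5; split; last first.
  move=> y1 y2 y3 y4 y5; rewrite (combE6 J e1 f3 f5) !combE.
  rewrite brE combZ.
  by congr comb; rewrite /b1' /b2'; field.
have g1E y1 y2 y3 y4 y5 y6 : g e1 (comb J e1 e3 e5 y1 y2 y3 y4 y5 y6) = sg * y6.
  by rewrite {1}(combE1 J e1 e3 e5) gE; ring.
case: fr => hE [g11 _ _ _] _ _ _; split=> //.
- by rewrite /f3 /f5 !(J_comb JJ) !g1E; split=> //; ring.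
- by rewrite /f3 /f5 !(J_comb JJ) !gE; split; field.
- by rewrite /f3 gE; ring.
- by rewrite /f5 (J_comb JJ) g1E mulr1.
Qed.

Lemma admissible_rotate a b1 b2 l c1 c2 c s : c ^+ 2 + s ^+ 2 = 1 ->
  admissible a b1 b2 l c1 c2 ->
  admissible a (c * b1 - s * b2) (c * b2 + s * b1) l c1 c2.
Proof.
move=> cs1 [e1 [e3 [e5 [fr ad]]]].
have gE := metric_comb JJ gJJ fr; have brE := br_comb fr ad.
pose f3 := comb J e1 e3 e5 0 0 c s 0 0.
(* Coordinates in the new frame, converted to the old one. *)
have combE y1 y2 y3 y4 y5 y6 : comb J e1 f3 e5 y1 y2 y3 y4 y5 y6 =
    comb J e1 e3 e5 y1 y2 (c * y3 - s * y4) (s * y3 + c * y4) y5 y6.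
  rewrite {1}/comb {1 2}(combE5 J e1 e3 e5) {1 2}(combE1 J e1 e3 e5) /f3.
  by rewrite !(J_comb JJ) !combZ !combD; congr comb; ring.
have s2 : s ^+ 2 = 1 - c ^+ 2 by rewrite -cs1; ring.
exists e1, f3, e5; split; last first.
  move=> y1 y2 y3 y4 y5; rewrite (combE6 J e1 f3 e5) !combE brE combZ.
  by congr comb; ring: s2.
have g1E y1 y2 y3 y4 y5 y6 : g e1 (comb J e1 e3 e5 y1 y2 y3 y4 y5 y6) = sg * y6.
  by rewrite {1}(combE1 J e1 e3 e5) gE; ring.
case: fr => hE [g11 _ _ g15] [_ _ g55] _ g16; split=> //.
- by rewrite /f3 (J_comb JJ) !g1E; split=> //; ring.
- rewrite {1}(combE5 J e1 e3 e5) {1}(combE6 J e1 e3 e5) /f3 !gE.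
  by split=> //; ring.
- by rewrite /f3 gE; ring: s2.
Qed.

Lemma admissible_rescale a b1 b2 l c1 c2 r : r != 0 ->
  admissible a b1 b2 l c1 c2 ->
  admissible (a / r) (b1 / r ^+ 2) (b2 / r ^+ 2) (l / r) (c1 / r ^+ 3) (c2 / r ^+ 3).
Proof.
move=> r0 [e1 [e3 [e5 [fr ad]]]]; have brE := br_comb fr ad.
have JZ k x : J (k *: x) = k *: J x by rewrite linearZ.
pose f1 := r *: e1; pose f5 := r^-1 *: e5.
(* Coordinates in the new frame, converted to the old one. *)
have combE y1 y2 y3 y4 y5 y6 : comb J f1 e3 f5 y1 y2 y3 y4 y5 y6 =
    comb J e1 e3 e5 (y1 * r) (y2 * r) y3 y4 (y5 / r) (y6 / r).
  by rewrite /comb /f1 /f5 !JZ !scalerA.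
exists f1, e3, f5; split; last first.
  move=> y1 y2 y3 y4 y5; rewrite (combE6 J f1 e3 f5) !combE !mul0r brE combZ.
  by congr comb; field.
case: fr => hE [g11 g13 g14 g15] [g35 g36 g55] g33 g16.
split=> [x|||//|]; rewrite /f1 /f5 ?JZ ?symE.
- by rewrite mulf_eq0 (negPf r0) hE.
- by rewrite g11 g13 g14 g15 !mulr0.
- by rewrite g35 g36 g55 !mulr0.
- by rewrite g16; field.
Qed.

End NormalizationMoves.

(** * Orbits of the parameters *)

Section NormalForm.
Variable R : realType.

Definition ad_matrix (a b1 b2 l c1 c2 : R) : 'M[R]_5 := mx5
  [:: [:: a; 0;  b1; - b2; c1];
      [:: 0; a;  b2;   b1; c2];
      [:: 0; 0;   0;    l; b2];
      [:: 0; 0; - l;    0; b1];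
      [:: 0; 0;   0;    0; - a]].

Lemma cube_root (c : R) : exists r, r ^+ 3 = c.
Proof.
pose p : {poly R} := 'X^3 - c%:P; pose b := 1 + `|c|.
have b1 : 1 <= b by rewrite lerDl.
have cb3 : `|c| <= b ^+ 3.
  by apply: le_trans (ler_eXnr _ b1) => //; rewrite lerDr.
have [||r _ /rootP] := @poly_ivt R p (- b) b.
- by rewrite ge0_cp // (le_trans _ b1).
- rewrite !hornerE exprNn -signr_odd /= expr1 mulN1r.
  by move: cb3; rewrite ler_norml subr_le0 subr_ge0 lerNl => /andP[cl cr]; apply/andP.
by rewrite !hornerE => /eqP; rewrite subr_eq0 => /eqP; exists r.
Qed.

(** [adm] stands for the set of parameters of one structure in all its adapted
frames; only its stability under the three moves matters. *)
Lemma exists_normal_parameters (adm : R -> R -> R -> R -> R -> R -> Prop) :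
  (forall a b1 b2 l c1 c2 w1 w2 t, adm a b1 b2 l c1 c2 ->
     let b1' := b1 + a * w2 - l * w1 in
     let b2' := b2 + a * w1 + l * w2 in
     adm a b1' b2' l
       (c1 + w1 * b1 - w2 * b2 + 2 * a * t + w1 * b1' - w2 * b2')
       (c2 + w1 * b2 + w2 * b1 + a * (w1 ^+ 2 + w2 ^+ 2) - w1 * b2' - w2 * b1')) ->
  (forall a b1 b2 l c1 c2 c s, c ^+ 2 + s ^+ 2 = 1 ->
     adm a b1 b2 l c1 c2 ->
     adm a (c * b1 - s * b2) (c * b2 + s * b1) l c1 c2) ->
  (forall a b1 b2 l c1 c2 r, r != 0 -> adm a b1 b2 l c1 c2 ->
     adm (a / r) (b1 / r ^+ 2) (b2 / r ^+ 2) (l / r) (c1 / r ^+ 3) (c2 / r ^+ 3)) ->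
  forall a b1 b2 l c1 c2, adm a b1 b2 l c1 c2 ->
  exists a' b1' b2' l' c1' c2', adm a' b1' b2' l' c1' c2' /\
    is_normal_form (ad_matrix a' b1' b2' l' c1' c2').
Proof.
move=> shift rotate rescale a b1 b2 l c1 c2 adm0.
have [a0|a0] := eqVneq a 0; last first.
  have na0 : - a != 0 by rewrite oppr_eq0.
  have := rescale _ _ _ _ _ _ _ na0 adm0.
  rewrite invrN mulrN mulfV // => adm1; set A1 := b1 / _ in adm1.
  set A2 := b2 / _ in adm1; set L := l * _ in adm1.
  have n0 : 1 + L ^+ 2 != 0 by rewrite gt_eqF // ltr_pwDl // sqr_ge0.
  (* w1 + i w2 solves one complex linear equation, whose determinant is the
     squared modulus of the difference - 1 + i L of the diagonal entries. *)
  pose w1 := (A2 + L * A1) / (1 + L ^+ 2).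
  pose w2 := (A1 - L * A2) / (1 + L ^+ 2).
  have z1 : A1 + (-1) * w2 - L * w1 = 0 by rewrite /w1 /w2; field.
  have z2 : A2 + (-1) * w1 + L * w2 = 0 by rewrite /w1 /w2; field.
  set C1 := c1 / _ in adm1.
  have := shift _ _ _ _ _ _ w1 w2 ((C1 + w1 * A1 - w2 * A2) / 2) adm1.
  rewrite /= z1 z2 => adm2; do 6!eexists; split; first exact: adm2.
  left; exists L; eexists; congr mx5; do ![congr (_ :: _)]; rewrite ?oppr0 ?opprK //.
  by field.
subst a.
(* Once a = b = 0, only the scale acts on c, with weight 3. *)
have case0 k1 k2 m : adm 0 0 0 m k1 k2 ->
  exists a' b1' b2' l' c1' c2', adm a' b1' b2' l' c1' c2' /\
    is_normal_form (ad_matrix a' b1' b2' l' c1' c2').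
  move=> adm1; have [k20|k20] := eqVneq k2 0; last first.
    have [r r3] := cube_root k2; have r0 : r != 0.
      by apply: contra_neq k20 => r0; rewrite -r3 r0 expr0n.
    have := rescale _ _ _ _ _ _ _ r0 adm1; rewrite !mul0r r3 divff // => adm2.
    do 6!eexists; split; first exact: adm2.
    by right; left; do 2!eexists; congr mx5; do ![congr (_ :: _)]; rewrite ?oppr0.
  subst k2; have [k10|k10] := eqVneq k1 0; last first.
    have [r r3] := cube_root k1; have r0 : r != 0.
      by apply: contra_neq k10 => r0; rewrite -r3 r0 expr0n.
    have := rescale _ _ _ _ _ _ _ r0 adm1; rewrite !mul0r r3 divff // => adm2.
    do 6!eexists; split; first exact: adm2.
    by right; right; left; eexists; congr mx5; do ![congr (_ :: _)]; rewrite ?oppr0.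
  subst k1; do 6!eexists; split; first exact: adm1.
  by do 3!right; left; eexists; congr mx5; do ![congr (_ :: _)]; rewrite ?oppr0.
have [l0|l0] := eqVneq l 0; last first.
  have := shift _ _ _ _ _ _ (b1 / l) (- b2 / l) 0 adm0 => /=.
  set B1 := b1 + _ - _; set B2 := b2 + _ + _.
  have -> : B1 = 0 by rewrite /B1; field.
  have -> : B2 = 0 by rewrite /B2; field.
  exact: case0.
subst l; pose n := Num.sqrt (b1 ^+ 2 + b2 ^+ 2).
have n2 : n ^+ 2 = b1 ^+ 2 + b2 ^+ 2 by rewrite sqr_sqrtr // addr_ge0 // sqr_ge0.
have [n0|n0] := eqVneq n 0.
  move: n2; rewrite n0 expr0n => /esym/eqP; rewrite paddr_eq0 ?sqr_ge0 // !sqrf_eq0.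
  by case/andP=> /eqP b10 /eqP b20; subst b1 b2; apply: case0 adm0.
have n_gt0 : 0 < n by rewrite lt_neqAle eq_sym n0 sqrtr_ge0.
(* The rotation that takes b1 + i b2 to i n. *)
have cs1 : (b2 / n) ^+ 2 + (b1 / n) ^+ 2 = 1.
  by rewrite !expr_div_n -mulrDl addrC -n2 divff // expf_neq0.
have := rotate _ _ _ _ _ _ _ _ cs1 adm0.
have -> : b2 / n * b1 - b1 / n * b2 = 0 by ring.
have -> : b2 / n * b2 + b1 / n * b1 = n.
  by rewrite ![_ / n * _]mulrAC -mulrDl -!expr2 addrC -n2 expr2 mulfK.
move=> adm1; have := shift _ _ _ _ _ _ 0 (c1 / (2 * n)) 0 adm1 => /=.
rewrite !(mul0r, mulr0, oppr0, addr0, add0r).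
have -> : c1 - c1 / (2 * n) * n - c1 / (2 * n) * n = 0 by field.
move=> adm2; have [c20|c20] := eqVneq c2 0.
  have r0 : Num.sqrt n != 0 by rewrite gt_eqF // sqrtr_gt0.
  have := rescale _ _ _ _ _ _ _ r0 adm2.
  rewrite c20 !mul0r sqr_sqrtr 1?ltW // divff // => adm3.
  do 6!eexists; split; first exact: adm3.
  by do 4!right; left; congr mx5; do ![congr (_ :: _)]; rewrite ?oppr0.
have [r r3] := cube_root c2; have r0 : r != 0.
  by apply: contra_neq c20 => r0; rewrite -r3 r0 expr0n.
have := rescale _ _ _ _ _ _ _ r0 adm2; rewrite !mul0r r3 divff // => adm3.
do 6!eexists; split; first exact: adm3.
do 5!right; exists (n / r ^+ 2); split; first by rewrite divr_ge0 ?sqr_ge0 // ltW.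
by congr mx5; do ![congr (_ :: _)]; rewrite ?oppr0.
Qed.

End NormalForm.

(** * From frames to bases *)

Section FrameToBasis.
Variables (R : realType) (V : vectType R) (br : {bilinear V -> V -> V}).
Variables (J : 'End(V)) (g : {symmetric V}) (h : {vspace V}).
Hypothesis dimV : \dim {:V} = 6%N.
Hypothesis dimh : (\dim h).+1 = \dim {:V}.
Hypothesis JJ : forall x, J (J x) = - x.
Hypothesis gJJ : forall x y, g (J x) (J y) = g x y.
Variable sg : R.
Hypothesis sg1 : sg * sg = 1.
Variables e1 e3 e5 : V.
Hypothesis fr : adapted J g h sg e1 e3 e5.

Lemma adapted_std_metric u v :
  sg * g u v = std_metric [tuple e1; J e1; e3; J e3; e5; J e5] u v.
Proof.
have eB := adapted_basis JJ gJJ dimV sg1 fr.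
rewrite {1}(coord_basis eB (memvf u)) {1}(coord_basis eB (memvf v)).
rewrite !(comb_sum _ erefl) (metric_comb JJ gJJ fr) mulrA sg1 mul1r.
by rewrite /std_metric /symtens /tens /=; ring.
Qed.

Lemma adapted_free_ideal : free [tuple e1; J e1; e3; J e3; e5].
Proof.
have := adapted_free JJ gJJ sg1 fr.
by rewrite (_ : tval _ = [:: e1; J e1; e3; J e3; e5] ++ [:: J e5]) // => /catl_free.
Qed.

Lemma adapted_span : h = <<[:: e1; J e1; e3; J e3; e5]>>%VS.
Proof.
have /eqP dimS := adapted_free_ideal.
apply/esym/eqP; rewrite eqEdim dimS /= -ltnS dimh dimV leqnn andbT.
have vh := mem_comb JJ gJJ sg1 fr; have JE := J_comb JJ e1 e3 e5.
apply/span_subvP=> x; rewrite !inE => /or4P[||| /orP[]] /eqP ->.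
- by rewrite (combE1 J e1 e3 e5) vh.
- by rewrite (combE1 J e1 e3 e5) JE vh.
- by rewrite (combE3 J e1 e3 e5) vh.
- by rewrite (combE3 J e1 e3 e5) JE vh.
- by rewrite (combE5 J e1 e3 e5) vh.
Qed.

Lemma ad_shape_matrix a b1 b2 l c1 c2 :
  ad_shape br J e1 e3 e5 a b1 b2 l c1 c2 ->
  matrix_in [tuple e1; J e1; e3; J e3; e5] (br (J e5)) = ad_matrix a b1 b2 l c1 c2.
Proof.
move=> ad; apply/matrixP=> i j; rewrite mxE.
set b := [tuple e1; J e1; e3; J e3; e5].
suff -> : br (J e5) b`_j = \sum_(k < 5) ad_matrix a b1 b2 l c1 c2 k j *: b`_k.
  exact: coord_sum_free adapted_free_ideal.
have -> : b`_j = comb J e1 e3 e5 (j == 0 :> nat)%:R (j == 1 :> nat)%:R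
    (j == 2 :> nat)%:R (j == 3 :> nat)%:R (j == 4 :> nat)%:R 0.
  by case: j => -[|[|[|[|[|[]]]]]] //= _;
    rewrite /comb !(scale0r, scale1r, addr0, add0r).
rewrite ad !big_ord_recl big_ord0 addr0 /comb scale0r addr0 !addrA !mxE /=.
by case: j => -[|[|[|[|[|[]]]]]] //= _;
  rewrite !(mulr0, mulr1, addr0, add0r, subr0, sub0r, oppr0).
Qed.

End FrameToBasis.

Theorem proposition3p10 (R : realType) (V : vectType R)
    (br : {bilinear V -> V -> V}) (J : 'End(V)) (g : {symmetric V})
    (h : {vspace V}) (br_lie : is_lie_bracket br) (dimV : \dim {:V} = 6%N)
    (h_ideal : is_codim1_abelian_ideal br h)
    (Jg_pK : is_pseudo_kahler br J g) (h0_iso : is_isotropic g (h0 J g h)) :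
  exists (s : bool) (e1 e2 e3 e4 e5 e6 : V),
    let e := [tuple e1; e2; e3; e4; e5; e6] in
    [/\ basis_of {:V} e,
        h = <<[:: e1; e2; e3; e4; e5]>>%VS,
        [/\ J e1 = e2, J e3 = e4 & J e5 = e6],
        (forall u v, (-1) ^+ s * g u v = std_metric e u v) &
        is_normal_form (matrix_in [tuple e1; e2; e3; e4; e5] (br e6))].
Proof.
have [[JJ _] nd gJJ _] := Jg_pK; have [dimh _ _] := h_ideal.
have [s [f1 [f3 [f5 frf]]]] := exists_adapted JJ gJJ dimV nd dimh h0_iso.
have sg1 : (-1) ^+ s * (-1) ^+ s = 1 :> R by rewrite -expr2 sqrr_sign.
have [a [b1 [b2 [l [c1 [c2 adf]]]]]] :=
  exists_ad_shape dimV br_lie h_ideal Jg_pK sg1 frf.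
have adm0 : admissible br J g h ((-1) ^+ s) a b1 b2 l c1 c2.
  by exists f1, f3, f5.
have [a' [b1' [b2' [l' [c1' [c2' [[e1 [e3 [e5 [fr ad]]]] nf]]]]]]] :=
  exists_normal_parameters
    (admissible_shift h_ideal JJ gJJ sg1) (admissible_rotate h_ideal JJ gJJ sg1)
    (admissible_rescale h_ideal JJ gJJ sg1) adm0.
exists s, e1, (J e1), e3, (J e3), e5, (J e5); split=> //.
- exact: (adapted_basis JJ gJJ dimV sg1 fr).
- exact: (adapted_span dimV dimh JJ gJJ sg1 fr).
- exact: (adapted_std_metric dimV JJ gJJ sg1 fr).
- by rewrite (ad_shape_matrix JJ gJJ sg1 fr ad).
Qed.
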